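(* For every fixed integer $r\ge 25$, among all rainbow-$K_4$-free $r$-colorings of $K_n$, the proportion of those that use at most five colors tends to $0$ as $n\to\infty$.
   Context: Write $[r]=\{1,\dots,r\}$. An $r$-coloring of $K_n$ (the complete graph on $n$ labeled vertices) is any function $\varphi:E(K_n)\to[r]$ (not necessarily a proper edge-coloring). It is rainbow-$K_4$-free if every copy of $K_4$ in $K_n$ has at least two edges of the same color. A coloring uses at most five colors if its image $\varphi(E(K_n))$ has at most five elements. *)

(* Defs.v *)
From mathcomp Require Import all_boot.

Set Implicit Arguments.
Unset Strict Implicit.
Unset Printing Implicit Defensive.

(* The edges of K_n on the vertex set 'I_n, as unordered pairs of vertices. *)
Notation edge n := {e : {set 'I_n} | #|e| == 2}.

(* 'I_r = {0, ..., r-1} plays the role of the palette [r] = {1, ..., r}. *)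
Notation coloring n r := {ffun edge n -> 'I_r}.

(* A copy of K_4 in K_n is determined by its set S of four vertices; its edges
   are those contained in S. *)
Definition rainbow_K4_free (n r : nat) (phi : coloring n r) : bool :=
  [forall S : {set 'I_n}, (#|S| == 4) ==>
    [exists e : edge n, exists f : edge n,
      [&& val e \subset S, val f \subset S, e != f & phi e == phi f]]].

Definition num_colors (n r : nat) (phi : coloring n r) : nat :=
  #|[set phi e | e : edge n]|.

Definition rainbow_K4_free_colorings (n r : nat) : {set coloring n r} :=
  [set phi | rainbow_K4_free phi].

Definition at_most_five_colors (n r : nat) : {set coloring n r} :=
  [set phi in rainbow_K4_free_colorings n r | num_colors phi <= 5].

(* Main.v *)
Require Import Defs.
From mathcomp Require Import all_boot all_order all_algebra.
From mathcomp Require Import all_classical all_reals all_analysis.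
From mathcomp Require Import zify.

Set Implicit Arguments.
Unset Strict Implicit.
Unset Printing Implicit Defensive.

Import Order.TTheory GRing.Theory Num.Theory.
Import numFieldNormedType.Exports.

(** Colorings with at most five colors number at most [2 ^ r * 5 ^ 'C(n, 2)]:
    choose the palette, then color freely with it. Many more rainbow-K_4-free
    colorings come from splitting the vertices into two halves, coloring every
    edge inside a half with one fixed color and the edges across the halves
    arbitrarily ([bipartite_colorings]). Four vertices always span two edges
    that do not cross the split ([two_edges_off_cut]), so no K_4 is rainbow. This
    gives [r ^ (k * (n - k))] colorings with [k = n./2], where
    [2 * (k * (n - k)) = 'C(n, 2) + k]. As [r >= 25 = 5 ^ 2], they number at least
    [5 ^ ('C(n, 2) + k)], so the proportion is at most [2 ^ r / 5 ^ k], which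
    tends to [0]. *)

Section Counting.

(* Gives the lemmas on finite sets precedence over their namesakes on classical
   sets up to the end of the section. *)
Import fintype boot.finset.
Local Open Scope nat_scope.

Lemma card_edge n : #|{: edge n}| = 'C(n, 2).
Proof.
rewrite card_sig -[in RHS](card_ord n) -card_draws.
by apply: eq_card => e; rewrite !inE.
Qed.

(** Union bound over the palettes of at most five colors, whose number is bounded
    crudely by that of all sets of colors; only independence of [n] matters. *)
Lemma card_at_most_five_colors n r :
  #|at_most_five_colors n r| <= 2 ^ r * 5 ^ 'C(n, 2).
Proof.
pose palettes := [set S : {set 'I_r} | #|S| <= 5].
pose colored_by (S : {set 'I_r}) := [set phi : coloring n r | phi \in ffun_on S].
have cover : at_most_five_colors n r \subset \bigcup_(S in palettes) colored_by S.
  apply/subsetP => phi; rewrite inE => /andP[_ few].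
  apply/bigcupP; exists [set phi e | e : edge n]; rewrite inE //.
  by apply/ffun_onP => e; apply: imset_f.
apply: leq_trans (subset_leq_card cover) _.
apply: (@leq_trans (\sum_(S in palettes) 5 ^ 'C(n, 2))).
  elim/big_ind2: _ => [|k X m Y leX leY|S]; first by rewrite cards0.
    exact: leq_trans (leq_card_setU X Y).1 (leq_add leX leY).
  rewrite inE => le5; rewrite cardsE card_ffun_on card_edge.
  by case: 'C(n, 2) => // m; rewrite leq_exp2r.
rewrite sum_nat_const leq_mul2r; apply/orP; right.
rewrite -[X in 2 ^ X]card_ord -cardsT -card_powerset; apply: subset_leq_card.
by apply/subsetP => S _; rewrite powersetE subsetT.
Qed.

(** Four vertices split as 2 + 2 have one pair inside each side; any other split
    puts at least three vertices, hence at least three pairs, on one side. *)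
Lemma two_edges_off_cut (T : finType) (A S : {set T}) :
  #|S| = 4 ->
  exists e f : {set T},
    [/\ #|e| = 2, #|f| = 2, e \subset S, f \subset S &
     [/\ e != f, (e \subset A) || (e \subset ~: A) &
                 (f \subset A) || (f \subset ~: A)]].
Proof.
move=> S4.
pose pairs (B : {set T}) := [set e : {set T} | e \subset B & #|e| == 2].
have splitS : #|S :&: A| + #|S :&: ~: A| = 4 by rewrite -setDE cardsID.
have disj : [disjoint pairs (S :&: A) & pairs (S :&: ~: A)].
  apply/pred0P => e; apply/negbTE; rewrite /= !inE !subsetI.
  apply/negP => /andP[/andP[/andP[_ eA] /eqP e2] /andP[/andP[_ eC] _]].
  have /eqP e0 : e == set0 by rewrite -subset0 -(setICr A) subsetI eA.
  by rewrite e0 cards0 in e2.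
(* If a and b = 4 - a of the vertices lie on the two sides, the number of pairs
   off the cut is 'C(a, 2) + 'C(b, 2), which is 6, 3, 2, 3 or 6. *)
have : 1 < #|pairs (S :&: A) :|: pairs (S :&: ~: A)|.
  have := disj; rewrite -(leq_card_setU _ _).2 => /eqP ->.
  rewrite !cards_draws; move: splitS.
  by case: #|S :&: A| => [|[|[|[|[|a]]]]] //=; case: #|_| => [|[|[|[|[|b]]]]].
case/card_gt1P => e [f [eP fP ef]]; exists e, f.
have off h : h \in pairs (S :&: A) :|: pairs (S :&: ~: A) ->
    [/\ #|h| = 2, h \subset S & (h \subset A) || (h \subset ~: A)].
  rewrite !inE !subsetI.
  by case/orP=> /andP[/andP[-> ->] /eqP ->]; rewrite ?orbT.
by have [? ? ?] := off e eP; have [? ? ?] := off f fP.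
Qed.

Definition cut_edges n (A : {set 'I_n}) : {set edge n} :=
  [set e : edge n | ~~ ((val e \subset A) || (val e \subset ~: A))].

Definition bipartite_colorings n r (A : {set 'I_n}) (c : 'I_r) :
    {set coloring n r} :=
  [set phi in pffun_on c (cut_edges A) predT].

Lemma bipartite_colorings_rainbow_K4_free n r (A : {set 'I_n}) (c : 'I_r) :
  bipartite_colorings A c \subset rainbow_K4_free_colorings n r.
Proof.
apply/subsetP => phi; rewrite !inE => /pffun_onP[/subsetP supp _].
have off_cut (h : edge n) : (val h \subset A) || (val h \subset ~: A) -> phi h = c.
  move=> off; apply/eqP; apply: contraLR off => nc.
  by have := supp h nc; rewrite inE.
apply/forallP => S; apply/implyP => /eqP /(two_edges_off_cut A).
move=> [e [f [/eqP e2 /eqP f2 eS fS [ef eA fA]]]].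
apply/existsP; exists (Sub e e2); apply/existsP; exists (Sub f f2).
by rewrite !off_cut ?SubK // eS fS eqxx andbT -(inj_eq val_inj) !SubK.
Qed.

Lemma card_cut_edges n (A : {set 'I_n}) :
  #|A| * #|~: A| <= #|cut_edges A|.
Proof.
pose pair_set (p : 'I_n * 'I_n) := [set p.1; p.2].
have inj : {in setX A (~: A) &, injective pair_set}.
  move=> [a b] [a' b'] /setXP[/= aA bA] /setXP[/= a'A b'A] eq_ab.
  have : a \in pair_set (a', b') by rewrite -eq_ab !inE eqxx.
  have : b \in pair_set (a', b') by rewrite -eq_ab !inE eqxx orbT.
  rewrite !inE /= in bA b'A *.
  case/orP=> /eqP eb; first by rewrite eb a'A in bA.
  by case/orP=> /eqP ea; [rewrite ea eb | rewrite -ea aA in b'A].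
rewrite -cardsX -(card_in_imset inj) -(card_imset (cut_edges A) val_inj).
apply: subset_leq_card; apply/subsetP => _ /imsetP[[a b] /setXP[/= aA bA] ->].
have ab : a != b by apply: contraTneq aA => ->; rewrite inE in bA.
have card2 : #|pair_set (a, b)| == 2 by rewrite cards2 ab.
apply/imsetP; exists (Sub (pair_set (a, b)) card2); last by rewrite SubK.
rewrite inE in bA.
by rewrite inE SubK !subUset !sub1set !inE aA (negbTE bA).
Qed.

Lemma card_rainbow_K4_free_colorings n r :
  0 < r ->
  r ^ (n./2 * (n - n./2)) <= #|rainbow_K4_free_colorings n r|.
Proof.
move=> r_gt0; pose A := [set i : 'I_n | i < n./2].
have cardA : #|A| = n./2.
  have le_n : n./2 <= n by lia.
  have -> : A = [set widen_ord le_n i | i : 'I_(n./2)].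
    apply/setP => i; rewrite inE; apply/idP/imsetP => [lt_i | [j _ ->]] //=.
    by exists (Ordinal lt_i); last exact: val_inj.
  by rewrite card_imset ?card_ord // => i j /(congr1 val) /= /val_inj.
have cardC : #|~: A| = n - n./2.
  by have := cardsC A; rewrite cardA card_ord; lia.
have sub := bipartite_colorings_rainbow_K4_free A (Ordinal r_gt0).
apply: leq_trans (subset_leq_card sub).
rewrite cardsE card_pffun_on cardT size_enum_ord leq_pexp2l //.
by have := card_cut_edges A; rewrite cardA cardC.
Qed.

(** A balanced cut has about half of the edges; the surplus [n./2] over exactly
    half is what makes the case [r = 25] work. *)
Lemma half_cut_size n : 2 * (n./2 * (n - n./2)) = 'C(n, 2) + n./2.
Proof.
have := odd_double_half n; case: (odd n) => <-; move: n./2 => k.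
  by rewrite bin2odd /= ?odd_double // add0n doubleK uphalf_double; nia.
by rewrite bin2 add0n -doubleMl !doubleK; case: k => [|k]; nia.
Qed.

(** The exponential gain [5 ^ n./2] is weakened to the linear bound
    [n.+1 <= 2 * 5 ^ n./2], so that the ratio compares with the harmonic
    sequence. *)
Lemma few_colors_negligible n r :
  25 <= r ->
  #|at_most_five_colors n r| * n.+1
    <= 2 ^ r.+1 * #|rainbow_K4_free_colorings n r|.
Proof.
move=> r25.
have n_lt : n.+1 <= 2 * 5 ^ n./2.
  have : n./2 < 5 ^ n./2 by apply: ltn_expl.
  lia.
have free_ge : 5 ^ 'C(n, 2) * 5 ^ n./2 <= #|rainbow_K4_free_colorings n r|.
  apply: leq_trans (card_rainbow_K4_free_colorings n _); last lia.
  rewrite -expnD -half_cut_size expnM.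
  by case: (n./2 * _) => // m; rewrite leq_exp2r.
apply: leq_trans (leq_mul (card_at_most_five_colors n r) n_lt) _.
by rewrite mulnACA expnSr leq_mul2l free_ge orbT.
Qed.

End Counting.

Local Open Scope classical_set_scope.
Local Open Scope ring_scope.

Theorem mainTheorem2 (R : realType) (r : nat) (hr : (25 <= r)%N) :
  (fun n : nat => #|at_most_five_colors n r|%:R /
                  #|rainbow_K4_free_colorings n r|%:R : R) @ \oo --> (0 : R).
Proof.
have free_gt0 n : 0 < #|rainbow_K4_free_colorings n r|%:R :> R.
  rewrite ltr0n; apply: leq_trans (card_rainbow_K4_free_colorings n _); last lia.
  by rewrite expn_gt0; apply/orP; left; lia.
apply: (@squeeze_cvgr _ _ _ _ (fun=> 0) (fun n => (2 ^ r.+1)%:R * harmonic n)).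
- near=> n; rewrite divr_ge0 ?ler0n //= ler_pdivrMr // mulrAC.
  rewrite ler_pdivlMr ?ltr0n // -!natrM ler_nat.
  exact: few_colors_negligible.
- exact: cvg_cst.
- rewrite -[X in _ --> X](mulr0 (2 ^ r.+1)%:R).
  by apply: cvgMr; exact: cvg_harmonic.
Unshelve. all: by end_near.
Qed.
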